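(* Let $\mathcal{P}1$ be the uplink total transmit power minimization problem $$\mathcal{P}1:\quad \min_{\mathbf{f}_{i,u},\,\lambda_{i,u}\ge 0,\ \forall i,u}\ \sum_{i,u}\lambda_{i,u}\quad\text{s.t.}\quad \max_{\mathbf{f}_{i,u}}\Gamma^{\rm ul}_{i,u}\ \ge\ \gamma_{i,u}\quad\forall i,u,$$ and let $\mathcal{P}2$ be the downlink total transmit power minimization problem $$\mathcal{P}2:\quad \min_{\mathbf{w}_{i,u},\ \forall i,u}\ \alpha\sum_{i,u}\mathbf{w}_{i,u}^H\mathbf{w}_{i,u}\quad\text{s.t.}\quad \Gamma^{\rm dl}_{i,u}\ \ge\ \gamma_{i,u}\quad\forall i,u,$$ where $\Gamma^{\rm ul}_{i,u}$ and $\Gamma^{\rm dl}_{i,u}$ are the quantized uplink and downlink SINRs defined in the context. Then $\mathcal{P}1$ equals (is equivalent to) the Lagrangian dual of $\mathcal{P}2$: the two problems have the same optimal value, with the optimal uplink powers $\lambda_{i,u}$ of $\mathcal{P}1$ playing the role of (coinciding with) the optimal Lagrange multipliers $\mu_{i,u}$ of the SINR constraints of $\mathcal{P}2$.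
   Context: Setting. $N_c,N_u,N_b$ are positive integers (numbers of cells, users per cell, antennas per base station). Indices: $i,j\in\{1,\dots,N_c\}$, $u,v\in\{1,\dots,N_u\}$; $\sum_{i,u}$ is the sum over all such pairs. The channels $\mathbf{h}_{i,j,u}\in\mathbb{C}^{N_b}$ (between base station $i$ and user $u$ of cell $j$) are given, $\mathbf{H}_{i,j}=[\mathbf{h}_{i,j,1},\dots,\mathbf{h}_{i,j,N_u}]$ and $\mathbf{H}_i=[\mathbf{H}_{i,1},\dots,\mathbf{H}_{i,N_c}]\in\mathbb{C}^{N_b\times N_cN_u}$. The quantizer gain is $\alpha\in(0,1]$ and $\beta=1-\alpha$. The target SINRs are $\gamma_{i,u}>0$. For a square matrix $\mathbf{A}$, $\mathrm{diag}(\mathbf{A})$ is the diagonal matrix with the same diagonal entries as $\mathbf{A}$. Uplink. For powers $\lambda_{i,u}\ge0$ let $\boldsymbol{\Lambda}$ be the $N_cN_u\times N_cN_u$ diagonal matrix with entries $\lambda_{1,1},\dots,\lambda_{1,N_u},\dots,\lambda_{N_c,1},\dots,\lambda_{N_c,N_u}$. The quantization noise covariance is $\mathbf{C}_{\mathbf{q}^{\rm ul}_i\mathbf{q}^{\rm ul}_i}=\alpha\beta\,\mathrm{diag}(\mathbf{H}_i\boldsymbol{\Lambda}\mathbf{H}_i^H+\mathbf{I}_{N_b})$. For a combiner $\mathbf{f}_{i,u}\in\mathbb{C}^{N_b}\setminus\{\mathbf{0}\}$, $$\Gamma^{\rm ul}_{i,u}=\frac{\alpha^2\lambda_{i,u}|\mathbf{f}_{i,u}^H\mathbf{h}_{i,i,u}|^2}{\alpha^2\sum_{(j,v)\ne(i,u)}\lambda_{j,v}|\mathbf{f}_{i,u}^H\mathbf{h}_{i,j,v}|^2+\mathbf{f}_{i,u}^H\mathbf{C}_{\mathbf{q}^{\rm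 ul}_i\mathbf{q}^{\rm ul}_i}\mathbf{f}_{i,u}+\alpha^2\|\mathbf{f}_{i,u}\|^2}.$$ Downlink. The precoder of base station $i$ is $\mathbf{W}_i=[\mathbf{w}_{i,1},\dots,\mathbf{w}_{i,N_u}]\in\mathbb{C}^{N_b\times N_u}$, the quantization noise covariance is $\mathbf{C}_{\mathbf{q}^{\rm dl}_i\mathbf{q}^{\rm dl}_i}=\alpha\beta\,\mathrm{diag}(\mathbf{W}_i\mathbf{W}_i^H)$, and $$\Gamma^{\rm dl}_{i,u}=\frac{\alpha^2|\mathbf{w}_{i,u}^H\mathbf{h}_{i,i,u}|^2}{\alpha^2\sum_{(j,v)\ne(i,u)}|\mathbf{w}_{j,v}^H\mathbf{h}_{j,i,u}|^2+\sum_{j=1}^{N_c}\mathbf{h}_{j,i,u}^H\mathbf{C}_{\mathbf{q}^{\rm dl}_j\mathbf{q}^{\rm dl}_j}\mathbf{h}_{j,i,u}+1}.$$ Lagrangian dual of the downlink problem. The SINR constraint of user $(i,u)$ is written in the equivalent form $c_{i,u}(\mathbf{W})\ge 0$ with $$c_{i,u}(\mathbf{W})=\frac{\alpha^2}{\gamma_{i,u}}|\mathbf{w}_{i,u}^H\mathbf{h}_{i,i,u}|^2-\alpha^2\sum_{(j,v)\ne(i,u)}|\mathbf{w}_{j,v}^H\mathbf{h}_{j,i,u}|^2-\sum_{j}\mathbf{h}_{j,i,u}^H\mathbf{C}_{\mathbf{q}^{\rm dl}_j\mathbf{q}^{\rm dl}_j}\mathbf{h}_{j,i,u}-1,$$ the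 Lagrangian is $\mathcal{L}=\alpha\sum_{i,u}\mathbf{w}_{i,u}^H\mathbf{w}_{i,u}-\sum_{i,u}\mu_{i,u}c_{i,u}(\mathbf{W})$ with multipliers $\mu_{i,u}\ge0$, and the Lagrangian dual is $\max_{\mu_{i,u}\ge0}\ \min_{\{\mathbf{w}_{i,u}\}}\mathcal{L}$. Optimal values are understood in $[0,+\infty]$ (an infeasible minimization problem has value $+\infty$; min and max of values are understood as inf and sup). *)

(* Defs.v *)
From HB Require Import structures.
From mathcomp Require Import all_boot all_order all_algebra.
From mathcomp Require Import complex.
From mathcomp Require Import all_classical all_reals all_analysis.
Set Implicit Arguments.
Unset Strict Implicit.
Unset Printing Implicit Defensive.
Import Order.TTheory GRing.Theory Num.Theory.
Local Open Scope classical_set_scope.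
Local Open Scope ring_scope.
Local Open Scope complex_scope.
Local Open Scope sesquilinear_scope.

(** MathComp(-Analysis) is used throughout; complex numbers are [R[i]] over a
    [realType] [R].  Cells, users and antennas are 0-based ordinals. *)

(** [h i j u] is the channel between base station [i] and user [u] of cell [j]. *)
Definition channels (R : realType) (Nc Nu Nb : nat) : Type :=
  'I_Nc -> 'I_Nc -> 'I_Nu -> 'cV[R[i]]_Nb.

Definition user_reals (R : realType) (Nc Nu : nat) : Type :=
  'I_Nc -> 'I_Nu -> R.

(** Combiners [f i u] or precoders [w i u]. *)
Definition user_vectors (R : realType) (Nc Nu Nb : nat) : Type :=
  'I_Nc -> 'I_Nu -> 'cV[R[i]]_Nb.

Definition inner (R : realType) (n : nat) (x y : 'cV[R[i]]_n) : R[i] :=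
  (x ^t* *m y) 0 0.

Definition sqmod (R : realType) (z : R[i]) : R := ComplexField.Normc.normc z ^+ 2.

(** [x^H A x]; only used for Hermitian [A], for which this number is real. *)
Definition quad_form (R : realType) (n : nat) (A : 'M[R[i]]_n)
  (x : 'cV[R[i]]_n) : R := complex.Re (inner x (A *m x)).

Definition sqnorm (R : realType) (n : nat) (x : 'cV[R[i]]_n) : R :=
  complex.Re (inner x x).

Definition diag_part (R : realType) (n : nat) (A : 'M[R[i]]_n) : 'M[R[i]]_n :=
  diag_mx (\row_k A k k).

(** [[h i j 1, ..., h i j Nu]] *)
Definition cell_channel_mx (R : realType) (Nc Nu Nb : nat)
  (h : channels R Nc Nu Nb) (i j : 'I_Nc) : 'M[R[i]]_(Nb, Nu) :=
  \matrix_(n, u) h i j u n 0.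

(** [mxvec] flattens in row-major order, so column [mxvec_index j u] of
    [channel_mx h i] is [h i j u], and the diagonal entry of [power_mx lam] at
    [mxvec_index j u] is [lam j u]. *)
Definition channel_mx (R : realType) (Nc Nu Nb : nat)
  (h : channels R Nc Nu Nb) (i : 'I_Nc) : 'M[R[i]]_(Nb, Nc * Nu) :=
  \matrix_(n < Nb) mxvec (\matrix_(j < Nc) row n (cell_channel_mx h i j)).

Definition power_mx (R : realType) (Nc Nu : nat) (lam : user_reals R Nc Nu) :
  'M[R[i]]_(Nc * Nu) := diag_mx (mxvec (\matrix_(j, u) (lam j u)%:C)).

Definition noise_cov_ul (R : realType) (Nc Nu Nb : nat)
  (h : channels R Nc Nu Nb) (alpha : R) (lam : user_reals R Nc Nu)
  (i : 'I_Nc) : 'M[R[i]]_Nb :=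
  (alpha * (1 - alpha))%:C *:
    diag_part (channel_mx h i *m power_mx lam *m (channel_mx h i) ^t* + 1%:M).

Definition sinr_ul (R : realType) (Nc Nu Nb : nat)
  (h : channels R Nc Nu Nb) (alpha : R) (lam : user_reals R Nc Nu)
  (i : 'I_Nc) (u : 'I_Nu) (f : 'cV[R[i]]_Nb) : R :=
  alpha ^+ 2 * lam i u * sqmod (inner f (h i i u)) /
  (alpha ^+ 2 * (\sum_(p : 'I_Nc * 'I_Nu | p != (i, u))
                   lam p.1 p.2 * sqmod (inner f (h i p.1 p.2)))
   + quad_form (noise_cov_ul h alpha lam i) f
   + alpha ^+ 2 * sqnorm f).

Definition max_sinr_ul (R : realType) (Nc Nu Nb : nat)
  (h : channels R Nc Nu Nb) (alpha : R) (lam : user_reals R Nc Nu)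
  (i : 'I_Nc) (u : 'I_Nu) : \bar R :=
  ereal_sup [set (sinr_ul h alpha lam i u f)%:E
            | f in [set f : 'cV[R[i]]_Nb | f != 0]].

Definition precoder_mx (R : realType) (Nc Nu Nb : nat)
  (w : user_vectors R Nc Nu Nb) (i : 'I_Nc) : 'M[R[i]]_(Nb, Nu) :=
  \matrix_(n, u) w i u n 0.

Definition noise_cov_dl (R : realType) (Nc Nu Nb : nat) (alpha : R)
  (w : user_vectors R Nc Nu Nb) (i : 'I_Nc) : 'M[R[i]]_Nb :=
  (alpha * (1 - alpha))%:C *:
    diag_part (precoder_mx w i *m (precoder_mx w i) ^t*).

Definition interference_dl (R : realType) (Nc Nu Nb : nat)
  (h : channels R Nc Nu Nb) (w : user_vectors R Nc Nu Nb)
  (i : 'I_Nc) (u : 'I_Nu) : R :=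
  \sum_(p : 'I_Nc * 'I_Nu | p != (i, u))
    sqmod (inner (w p.1 p.2) (h p.1 i u)).

Definition quant_noise_dl (R : realType) (Nc Nu Nb : nat)
  (h : channels R Nc Nu Nb) (alpha : R) (w : user_vectors R Nc Nu Nb)
  (i : 'I_Nc) (u : 'I_Nu) : R :=
  \sum_(j < Nc) quad_form (noise_cov_dl alpha w j) (h j i u).

Definition sinr_dl (R : realType) (Nc Nu Nb : nat)
  (h : channels R Nc Nu Nb) (alpha : R) (w : user_vectors R Nc Nu Nb)
  (i : 'I_Nc) (u : 'I_Nu) : R :=
  alpha ^+ 2 * sqmod (inner (w i u) (h i i u)) /
  (alpha ^+ 2 * interference_dl h w i u + quant_noise_dl h alpha w i u + 1).

Definition nonneg_reals (R : realType) (Nc Nu : nat) :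
  set (user_reals R Nc Nu) := [set x | forall i u, 0 <= x i u].

(** As in the problem itself, the combiners are formal decision variables, but
    the SINR constraint maximizes over the combiner. *)
Definition P1_feasible (R : realType) (Nc Nu Nb : nat)
  (h : channels R Nc Nu Nb) (alpha : R) (gamma : user_reals R Nc Nu) :
  set (user_vectors R Nc Nu Nb * user_reals R Nc Nu) :=
  [set x | [/\ forall i u, x.1 i u != 0, nonneg_reals x.2 &
     forall i u, ((gamma i u)%:E <= max_sinr_ul h alpha x.2 i u)%E]].

Definition P1_objective (R : realType) (Nc Nu Nb : nat)
  (x : user_vectors R Nc Nu Nb * user_reals R Nc Nu) : R :=
  \sum_(i < Nc) \sum_(u < Nu) x.2 i u.

Definition P1_value (R : realType) (Nc Nu Nb : nat)
  (h : channels R Nc Nu Nb) (alpha : R) (gamma : user_reals R Nc Nu) : \bar R :=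
  ereal_inf [set (P1_objective x)%:E | x in P1_feasible h alpha gamma].

Definition P1_optimal (R : realType) (Nc Nu Nb : nat)
  (h : channels R Nc Nu Nb) (alpha : R) (gamma : user_reals R Nc Nu)
  (x : user_vectors R Nc Nu Nb * user_reals R Nc Nu) : Prop :=
  P1_feasible h alpha gamma x /\
  forall y, P1_feasible h alpha gamma y -> P1_objective x <= P1_objective y.

Definition P2_feasible (R : realType) (Nc Nu Nb : nat)
  (h : channels R Nc Nu Nb) (alpha : R) (gamma : user_reals R Nc Nu) :
  set (user_vectors R Nc Nu Nb) :=
  [set w | forall i u, gamma i u <= sinr_dl h alpha w i u].

Definition P2_objective (R : realType) (Nc Nu Nb : nat) (alpha : R)
  (w : user_vectors R Nc Nu Nb) : R :=
  alpha * \sum_(i < Nc) \sum_(u < Nu) sqnorm (w i u).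

Definition P2_constraint (R : realType) (Nc Nu Nb : nat)
  (h : channels R Nc Nu Nb) (alpha : R) (gamma : user_reals R Nc Nu)
  (w : user_vectors R Nc Nu Nb) (i : 'I_Nc) (u : 'I_Nu) : R :=
  alpha ^+ 2 / gamma i u * sqmod (inner (w i u) (h i i u))
  - alpha ^+ 2 * interference_dl h w i u
  - quant_noise_dl h alpha w i u
  - 1.

Definition P2_lagrangian (R : realType) (Nc Nu Nb : nat)
  (h : channels R Nc Nu Nb) (alpha : R) (gamma : user_reals R Nc Nu)
  (mu : user_reals R Nc Nu) (w : user_vectors R Nc Nu Nb) : R :=
  P2_objective alpha w
  - \sum_(i < Nc) \sum_(u < Nu) mu i u * P2_constraint h alpha gamma w i u.

Definition P2_dual_function (R : realType) (Nc Nu Nb : nat)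
  (h : channels R Nc Nu Nb) (alpha : R) (gamma : user_reals R Nc Nu)
  (mu : user_reals R Nc Nu) : \bar R :=
  ereal_inf (range (fun w : user_vectors R Nc Nu Nb =>
                      (P2_lagrangian h alpha gamma mu w)%:E)).

Definition P2_dual_value (R : realType) (Nc Nu Nb : nat)
  (h : channels R Nc Nu Nb) (alpha : R) (gamma : user_reals R Nc Nu) : \bar R :=
  ereal_sup [set P2_dual_function h alpha gamma mu
            | mu in @nonneg_reals R Nc Nu].

Definition P2_dual_optimal (R : realType) (Nc Nu Nb : nat)
  (h : channels R Nc Nu Nb) (alpha : R) (gamma : user_reals R Nc Nu)
  (mu : user_reals R Nc Nu) : Prop :=
  nonneg_reals mu /\
  forall nu, nonneg_reals nu ->
    (P2_dual_function h alpha gamma nu <= P2_dual_function h alpha gamma mu)%E.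

(* Main.v *)
(** Write [n p f] for the noise-plus-interference power at the output of the
    combiner [f] of user [p], an affine function of the powers with nonnegative
    coefficients and constant term [alpha |f|^2].  The Lagrangian is the sum of
    the multipliers plus, for each user, a quadratic form in its precoder; this
    form is nonnegative exactly when the uplink SINR of that user, with the
    multipliers as powers, is at most its target for every combiner.  Hence the
    dual maximizes the total power subject to [best SINR <= target], while P1
    minimizes it subject to [best SINR >= target].  Because scaling the powers
    by [c > 1] scales [n] by strictly less than [c], every dual feasible point
    lies below every P1 feasible one.  The coordinatewise supremum of the dual
    feasible points is dual feasible, and is P1 feasible since otherwise one of
    its coordinates could be raised; so both problems have this point as their
    unique optimum.  If the dual is unbounded, P1 is infeasible. *)

Require Import Defs.
From HB Require Import structures.
From mathcomp Require Import all_boot all_order all_algebra.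
From mathcomp Require Import complex.
From mathcomp Require Import all_classical all_reals all_analysis.
From mathcomp Require Import ring lra.
Set Implicit Arguments.
Unset Strict Implicit.
Unset Printing Implicit Defensive.
Import Order.TTheory GRing.Theory Num.Theory.
Local Open Scope ring_scope.
Local Open Scope complex_scope.
Local Open Scope sesquilinear_scope.

(** * Power control for affine interference, free of the network model *)

Section PowerControl.
Variables (R : realType) (I : finType) (V : Type).
Variables (a : R) (gamma : I -> R) (normV : V -> R).
Variables (signal : I -> V -> R) (gain : I -> I -> V -> R) (bnd : I -> I -> R).
Hypotheses (a_gt0 : 0 < a) (gamma_gt0 : forall p, 0 < gamma p).
Hypotheses (normV_ge0 : forall f, 0 <= normV f).
Hypotheses (gain_ge0 : forall p q f, 0 <= gain p q f).
Hypotheses (signal_ge0 : forall p f, 0 <= signal p f).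
Hypotheses (bnd_ge0 : forall p q, 0 <= bnd p q).
Hypothesis signal_le : forall p f, signal p f <= bnd p p * normV f.
Hypothesis gain_le : forall p q f, gain p q f <= bnd p q * normV f.

Definition noise_interference (lam : I -> R) (p : I) (f : V) : R :=
  a * normV f + \sum_q lam q * gain p q f.

(** Without divisions: the best SINR of each [p] is at most [gamma p]. *)
Definition sinr_le (lam : I -> R) : Prop :=
  forall p f, lam p * signal p f <= gamma p * noise_interference lam p f.

(** Likewise: the best SINR, as a supremum over [f], is at least [gamma p]. *)
Definition sinr_ge (lam : I -> R) : Prop :=
  forall p g, g < gamma p ->
    exists f, g * noise_interference lam p f < lam p * signal p f.

Lemma noise_interference_mono lam mu p f :
  (forall q, mu q <= lam q) ->
  noise_interference mu p f <= noise_interference lam p f.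
Proof.
by move=> le_mu; rewrite lerD2l ler_sum // => q _; apply: ler_wpM2r.
Qed.

Lemma noise_interference_lb lam p f :
  (forall q, 0 <= lam q) -> a * normV f <= noise_interference lam p f.
Proof. by move=> lam0; rewrite lerDl sumr_ge0 // => q _; rewrite mulr_ge0. Qed.

Lemma noise_interference_ub lam p f :
  (forall q, 0 <= lam q) ->
  noise_interference lam p f <= (a + \sum_q lam q * bnd p q) * normV f.
Proof.
move=> lam0; rewrite mulrDl lerD2l mulr_suml ler_sum // => q _.
by rewrite -mulrA ler_wpM2l.
Qed.

(** Quantitative strict subhomogeneity: the noise does not scale with the powers, which leaves the
    deficit [(c - 1) * (a * normV f)]. *)
Lemma noise_interference_scale c lam p f :
  noise_interference (fun q => c * lam q) p f =
  c * noise_interference lam p f - (c - 1) * (a * normV f).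
Proof.
rewrite /noise_interference mulrDr mulr_sumr.
under eq_bigr do rewrite -mulrA.
ring.
Qed.

(* Scale [lam] up by the largest ratio [c = mu p / lam p]: if [c > 1], the
   unscaled noise [a * normV f] leaves a uniform gap at [p]. *)
Lemma sinr_le_ge_dominated lam mu :
  (forall p, 0 <= lam p) -> (forall p, 0 <= mu p) ->
  sinr_ge lam -> sinr_le mu -> forall p, mu p <= lam p.
Proof.
move=> lam0 mu0 lam_ge mu_le p0.
(* The level [0] lies below every target and already forces positive powers, so the ratios can be
   formed. *)
have lam_gt0 p : 0 < lam p.
  have [f] := lam_ge p 0 (gamma_gt0 p).
  rewrite mul0r => lam_signal; rewrite lt0r lam0 andbT.
  by apply: contraTneq lam_signal => ->; rewrite mul0r ltxx.
rewrite leNgt; apply/negP => lt_p0.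
case: (@arg_maxP _ _ _ p0 xpredT (fun p => mu p / lam p) isT) => p _ max_p.
set c := mu p / lam p in max_p.
have c_gt1 : 1 < c.
  by apply: lt_le_trans (max_p p0 isT); rewrite ltr_pdivlMr // mul1r.
have mu_pE : mu p = c * lam p by rewrite divfK // gt_eqF.
have mu_c q : mu q <= c * lam q by rewrite -ler_pdivrMr //; apply: max_p.
clearbody c.
pose b := a + \sum_q lam q * bnd p q.
have b_gt0 : 0 < b.
  by rewrite ltr_pwDl // sumr_ge0 // => q _; rewrite mulr_ge0.
have c_gt0 : 0 < c := lt_trans ltr01 c_gt1.
(* Since the noise is at most [b * normV f], the deficit is at least [(c - 1) * a / b] times the
   noise; dividing by [c] gives the relative gap [1 - k]. *)
pose k := 1 - (c - 1) * a / (b * c).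
have [|f] := lam_ge p (gamma p * k).
  rewrite gtr_pMr // ltrBlDr ltrDl.
  by apply: divr_gt0; rewrite mulr_gt0 ?subr_gt0.
rewrite ltNge => /negP; apply; rewrite -(ler_pM2l c_gt0).
rewrite mulrA -mu_pE; apply: le_trans (mu_le p f) _.
rewrite [leRHS]mulrCA -!mulrA ler_pM2l //.
apply: le_trans (noise_interference_mono p f mu_c) _.
rewrite noise_interference_scale.
have -> : k * (c * noise_interference lam p f) =
  c * noise_interference lam p f
    - (c - 1) * (a * (noise_interference lam p f / b)).
  by rewrite /k; field; rewrite !gt_eqF.
rewrite lerD2l lerN2 ler_pM2l ?subr_gt0 // ler_pM2l //.
by rewrite ler_pdivrMr // mulrC; apply: noise_interference_ub.
Qed.

(** If every [f] kept the SINR of [p] at or below some [g < gamma p], power [p] could be raised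
    slightly: the slack [(gamma p - g) * (a * normV f)] pays for the extra signal, and the other
    constraints only gain noise on the right. *)
Lemma sinr_le_greatest_ge lam :
  (forall p, 0 <= lam p) -> sinr_le lam ->
  (forall mu, (forall p, 0 <= mu p) -> sinr_le mu -> forall p, mu p <= lam p) ->
  sinr_ge lam.
Proof.
move=> lam0 lam_le lam_max p g lt_g; apply: contrapT => /forallNP no_f.
(* The added [1] keeps the divisor positive when [bnd p p] vanishes. *)
pose b := bnd p p + 1.
have b_gt0 : 0 < b by rewrite ltr_wpDl.
pose e := (gamma p - g) * a / b.
have e_gt0 : 0 < e by rewrite divr_gt0 ?mulr_gt0 ?subr_gt0.
pose mu q := lam q + (if q == p then e else 0).
have lam_mu q : lam q <= mu q by rewrite lerDl; case: ifP => // _; apply: ltW.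
have: mu p <= lam p.
  apply: lam_max => [q|q f]; first exact: le_trans (lam_mu q).
  have le_mu := noise_interference_mono q f lam_mu.
  apply: le_trans (ler_wpM2l (ltW (gamma_gt0 q)) le_mu).
  rewrite /mu; case: eqP => [->|_]; last by rewrite addr0.
  have /negP := no_f f; rewrite -leNgt => le_g.
  have -> : gamma p * noise_interference lam p f =
    g * noise_interference lam p f + (gamma p - g) * noise_interference lam p f.
    by ring.
  rewrite mulrDl lerD // /e -!mulrA ler_pM2l ?subr_gt0 //.
  apply: le_trans (noise_interference_lb p f lam0).
  rewrite ler_pM2l // mulrC ler_pdivrMr // mulrC.
  by apply: le_trans (signal_le p f) _; rewrite ler_wpM2r // lerDl.
by rewrite /mu eqxx gerDl leNgt e_gt0.
Qed.

(** The left side of constraint [p] involves only the power of [p], and the right side increases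
    with all powers, so the constraints pass to coordinatewise suprema. *)
Lemma sinr_le_greatest M :
  (forall mu, (forall p, 0 <= mu p) -> sinr_le mu -> \sum_p mu p <= M) ->
  exists lam, [/\ forall p, 0 <= lam p, sinr_le lam &
    forall mu, (forall p, 0 <= mu p) -> sinr_le mu -> forall p, mu p <= lam p].
Proof.
move=> leM.
pose S p : set R :=
  [set mu p | mu in [set mu | (forall q, 0 <= mu q) /\ sinr_le mu]]%classic.
have ubS p : has_ubound (S p).
  exists M => _ [mu [mu0 mu_le] <-]; apply: le_trans (leM _ mu0 mu_le).
  by rewrite (bigD1 p) //= lerDl sumr_ge0.
pose lam p := sup (S p).
have lam_max mu : (forall p, 0 <= mu p) -> sinr_le mu -> forall p, mu p <= lam p.
  by move=> mu0 mu_le p; apply: ub_le_sup => //; exists mu.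
have zero_le : sinr_le (fun=> 0).
  move=> p f; rewrite mul0r; apply: mulr_ge0; first exact: ltW.
  apply: le_trans (noise_interference_lb p f (fun=> lexx 0)).
  by rewrite mulr_ge0 // ltW.
have lam0 p : 0 <= lam p by apply: (lam_max (fun=> 0)).
exists lam; split=> // p f.
have [s0|s_neq0] := eqVneq (signal p f) 0.
  rewrite s0 mulr0; apply: mulr_ge0; first exact: ltW.
  apply: le_trans (noise_interference_lb p f lam0).
  by rewrite mulr_ge0 // ltW.
have s_gt0 : 0 < signal p f by rewrite lt0r s_neq0 signal_ge0.
rewrite -ler_pdivlMr //; apply: ge_sup.
  by exists 0, (fun=> 0).
move=> _ [mu [mu0 mu_le] <-]; rewrite ler_pdivlMr //.
apply: le_trans (mu_le p f) _; rewrite ler_pM2l //.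
exact/noise_interference_mono/lam_max.
Qed.

End PowerControl.

(** * Squared moduli, norms and quadratic forms of complex vectors *)

Section ComplexVectors.
Variables (R : realType) (n : nat).
Implicit Types (x y : 'cV[R[i]]_n) (z : R[i]).

Lemma sqmod_ge0 z : 0 <= sqmod z.
Proof. exact: sqr_ge0. Qed.

Lemma sqmod_mulJ z : z * Num.conj z = (sqmod z)%:C.
Proof. by rewrite -normCK -rmorphXn. Qed.

Lemma sqmodZ (c : R) z : sqmod (c%:C * z) = c ^+ 2 * sqmod z.
Proof.
rewrite /sqmod ComplexField.Normc.normcM exprMn; congr (_ * _).
by rewrite /= expr0n addr0 sqrtr_sqr real_normK ?num_real.
Qed.

Lemma innerE x y : inner x y = \sum_k Num.conj (x k 0) * y k 0.
Proof. by rewrite /inner mxE; apply: eq_bigr => k _; rewrite !mxE. Qed.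

Lemma sqmod_innerZl (c : R) x y :
  sqmod (inner (c%:C *: x) y) = c ^+ 2 * sqmod (inner x y).
Proof.
rewrite -sqmodZ; congr sqmod; rewrite !innerE mulr_sumr.
apply: eq_bigr => k _; rewrite !mxE rmorphM mulrA; congr (_ * _ * _).
exact: conjc_real.
Qed.

Lemma sqnormE x : sqnorm x = \sum_k sqmod (x k 0).
Proof.
rewrite /sqnorm innerE.
under eq_bigr do rewrite mulrC sqmod_mulJ.
by rewrite -rmorph_sum.
Qed.

Lemma sqnorm_ge0 x : 0 <= sqnorm x.
Proof. by rewrite sqnormE sumr_ge0 // => k _; apply: sqmod_ge0. Qed.

Lemma sqnormZ (c : R) x : sqnorm (c%:C *: x) = c ^+ 2 * sqnorm x.
Proof.
rewrite !sqnormE mulr_sumr; apply: eq_bigr => k _.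
by rewrite mxE sqmodZ.
Qed.

Lemma sqmod_le_sqnorm x k : sqmod (x k 0) <= sqnorm x.
Proof.
by rewrite sqnormE (bigD1 k) //= lerDl sumr_ge0 // => j _; apply: sqmod_ge0.
Qed.

Lemma sqnorm_gt0 x : x != 0 -> 0 < sqnorm x.
Proof.
move=> x_neq0; rewrite lt0r sqnorm_ge0 andbT; apply: contra x_neq0 => /eqP x0.
apply/eqP/matrixP => k j; rewrite ord1 mxE.
apply: ComplexField.Normc.eq0_normc; apply/eqP.
by rewrite -sqrf_eq0 eq_le sqr_ge0 andbT -x0; apply: sqmod_le_sqnorm.
Qed.

Lemma normc_ge0 z : 0 <= ComplexField.Normc.normc z.
Proof. by case: z => a b; apply: sqrtr_ge0. Qed.

Lemma normc_conj z :
  ComplexField.Normc.normc (Num.conj z) = ComplexField.Normc.normc z.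
Proof. by case: z => a b /=; rewrite sqrrN. Qed.

(** A cruder bound than Cauchy-Schwarz, from the triangle inequality; any constant depending on [y]
    alone will do. *)
Lemma sqmod_inner_le x y :
  sqmod (inner x y) <=
  (\sum_k ComplexField.Normc.normc (y k 0)) ^+ 2 * sqnorm x.
Proof.
have -> : sqnorm x = Num.sqrt (sqnorm x) ^+ 2.
  by rewrite sqr_sqrtr // sqnorm_ge0.
rewrite -exprMn ler_sqr ?nnegrE ?normc_ge0 //; last first.
  by rewrite mulr_ge0 ?sqrtr_ge0 // sumr_ge0 // => k _; apply: normc_ge0.
rewrite innerE mulr_suml.
apply: (big_ind2 (fun (z : R[i]) (r : R) => ComplexField.Normc.normc z <= r)).
- by rewrite ComplexField.Normc.normc0.
- move=> z1 r1 z2 r2 le1 le2; apply: le_trans (lerD le1 le2).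
  exact: le_normcD.
- move=> k _; rewrite ComplexField.Normc.normcM normc_conj mulrC.
  apply: ler_wpM2l; first exact: normc_ge0.
  rewrite -[leLHS]ger0_norm ?normc_ge0 // -sqrtr_sqr.
  by apply: ler_wsqrtr; apply: sqmod_le_sqnorm.
Qed.

Lemma quad_form_diag_part (c : R) (A : 'M[R[i]]_n) (d : 'I_n -> R) x :
  (forall k, A k k = (d k)%:C) ->
  quad_form (c%:C *: diag_part A) x = c * \sum_k d k * sqmod (x k 0).
Proof.
move=> diagA; rewrite /quad_form innerE.
have -> : \sum_k Num.conj (x k 0) * ((c%:C *: diag_part A) *m x) k 0 =
    (c * \sum_k d k * sqmod (x k 0))%:C.
  rewrite rmorphM rmorph_sum mulr_sumr; apply: eq_bigr => k _ /=.
  rewrite -scalemxAl mul_diag_mx !mxE diagA rmorphM /= -sqmod_mulJ.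
  by ring.
by [].
Qed.

End ComplexVectors.

Lemma channel_gram_diag (R : realType) (Nc Nu Nb : nat)
    (h : channels R Nc Nu Nb) (lam : user_reals R Nc Nu) i k :
  (channel_mx h i *m power_mx lam *m channel_mx h i ^t* + 1%:M) k k =
  (\sum_(p : 'I_Nc * 'I_Nu) lam p.1 p.2 * sqmod (h i p.1 p.2 k 0) + 1)%:C.
Proof.
rewrite mxE [1%:M _ _]mxE eqxx rmorphD; congr (_ + _).
(* Passes from flattened column indices back to pairs of a cell and a user. *)
rewrite mxE (reindex _ (curry_mxvec_bij _ _)) rmorph_sum.
apply: eq_bigr => -[j u] _ /=.
rewrite mul_mx_diag !mxE !mxvecE !mxE rmorphM /= -sqmod_mulJ.
by rewrite [RHS]mulrCA mulrA.
Qed.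

Lemma precoder_gram_diag (R : realType) (Nc Nu Nb : nat)
    (w : user_vectors R Nc Nu Nb) i k :
  (precoder_mx w i *m precoder_mx w i ^t*) k k =
  (\sum_u sqmod (w i u k 0))%:C.
Proof.
rewrite mxE rmorph_sum; apply: eq_bigr => u _.
by rewrite !mxE; apply: sqmod_mulJ.
Qed.

(** * The quantized network as an instance of power control *)

Section Network.
Variables (R : realType) (Nc Nu Nb : nat).
Variables (h : channels R Nc Nu Nb) (alpha : R) (gamma : user_reals R Nc Nu).
Hypotheses (alpha_gt0 : 0 < alpha) (alpha_le1 : alpha <= 1).
Hypothesis gamma_gt0 : forall i u, 0 < gamma i u.

Local Notation user := ('I_Nc * 'I_Nu)%type.
Implicit Types (p q : user) (f : 'cV[R[i]]_Nb) (w : user_vectors R Nc Nu Nb).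
Implicit Types lam mu : user_reals R Nc Nu.

(** Symmetric in the moduli of channel and vector: the same number is the uplink noise that [q]
    causes in a combiner [f] and the downlink noise that a precoder [f] causes at [q]. This is why
    duality survives quantization. *)
Definition quant_gain i q f : R :=
  alpha * (1 - alpha) * \sum_k sqmod (h i q.1 q.2 k 0) * sqmod (f k 0).

Definition user_signal p f : R :=
  alpha ^+ 2 * sqmod (inner f (h p.1 p.1 p.2)).

(** In the uplink, the power received through the combiner [f] of [p] per unit
    of power sent by [q]; in the downlink, the power received by [q] from the
    precoder [f] of [p]. *)
Definition user_gain p q f : R :=
  (if q == p then 0 else alpha ^+ 2 * sqmod (inner f (h p.1 q.1 q.2)))
  + quant_gain p.1 q f.

(** The factor [alpha] is [alpha ^+ 2 + alpha * (1 - alpha)], so the beam term and the quantization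
    term are bounded together. *)
Definition gain_bound p q : R :=
  alpha * (\sum_k ComplexField.Normc.normc (h p.1 q.1 q.2 k 0)) ^+ 2.

Local Notation flat lam := (fun p => lam p.1 p.2).
Local Notation noise lam :=
  (noise_interference alpha (@sqnorm R Nb) user_gain (flat lam)).

Local Notation ul_feasible lam :=
  (sinr_ge alpha (flat gamma) (@sqnorm R Nb) user_signal user_gain (flat lam)).
Local Notation dual_feasible mu :=
  (sinr_le alpha (flat gamma) (@sqnorm R Nb) user_signal user_gain (flat mu)).

Let alphaB_ge0 : 0 <= alpha * (1 - alpha).
Proof. by rewrite mulr_ge0 ?subr_ge0 // ltW. Qed.

Lemma user_signal_ge0 p f : 0 <= user_signal p f.
Proof. by rewrite mulr_ge0 ?sqr_ge0 ?sqmod_ge0. Qed.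

Lemma quant_gain_ge0 i q f : 0 <= quant_gain i q f.
Proof.
by rewrite mulr_ge0 // sumr_ge0 // => k _; rewrite mulr_ge0 ?sqmod_ge0.
Qed.

Lemma user_gain_ge0 p q f : 0 <= user_gain p q f.
Proof.
rewrite addr_ge0 ?quant_gain_ge0 //; case: ifP => // _.
by rewrite mulr_ge0 ?sqr_ge0 ?sqmod_ge0.
Qed.

Lemma gain_bound_ge0 p q : 0 <= gain_bound p q.
Proof. by rewrite mulr_ge0 ?sqr_ge0 // ltW. Qed.

Lemma quant_gain_le i q f :
  quant_gain i q f <= alpha * (1 - alpha) *
    ((\sum_k ComplexField.Normc.normc (h i q.1 q.2 k 0)) ^+ 2 * sqnorm f).
Proof.
rewrite ler_wpM2l // sqnormE mulr_sumr ler_sum // => k _.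
rewrite ler_wpM2r ?sqmod_ge0 // ler_sqr ?nnegrE ?normc_ge0 ?sumr_ge0 //.
  by rewrite (bigD1 k) //= lerDl sumr_ge0 // => j _; apply: normc_ge0.
by move=> j _; apply: normc_ge0.
Qed.

Lemma user_signal_gain_le p q f :
  alpha ^+ 2 * sqmod (inner f (h p.1 q.1 q.2)) + quant_gain p.1 q f
  <= gain_bound p q * sqnorm f.
Proof.
apply: le_trans (lerD (ler_wpM2l (sqr_ge0 alpha) (sqmod_inner_le f _))
  (quant_gain_le _ _ _)) _.
by rewrite /gain_bound le_eqVlt; apply/orP; left; apply/eqP; ring.
Qed.

Lemma user_signal_le p f : user_signal p f <= gain_bound p p * sqnorm f.
Proof.
by apply: le_trans (user_signal_gain_le p p f); rewrite lerDl quant_gain_ge0.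
Qed.

Lemma user_gain_le p q f : user_gain p q f <= gain_bound p q * sqnorm f.
Proof.
apply: le_trans (user_signal_gain_le p q f).
by rewrite lerD2r; case: ifP => // _; rewrite mulr_ge0 ?sqr_ge0 ?sqmod_ge0.
Qed.

Lemma user_signalZ (c : R) p f :
  user_signal p (c%:C *: f) = c ^+ 2 * user_signal p f.
Proof. by rewrite /user_signal sqmod_innerZl mulrCA. Qed.

Lemma user_gainZ (c : R) p q f :
  user_gain p q (c%:C *: f) = c ^+ 2 * user_gain p q f.
Proof.
rewrite /user_gain mulrDr; congr (_ + _).
  by case: ifP => _; rewrite ?mulr0 // sqmod_innerZl mulrCA.
rewrite /quant_gain mulrCA; congr (_ * _); rewrite mulr_sumr.
by apply: eq_bigr => k _; rewrite mxE sqmodZ mulrCA.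
Qed.

Lemma noiseZ lam (c : R) p f :
  noise lam p (c%:C *: f) = c ^+ 2 * noise lam p f.
Proof.
rewrite /noise_interference mulrDr sqnormZ mulrCA; congr (_ + _).
by rewrite mulr_sumr; apply: eq_bigr => q _; rewrite user_gainZ mulrCA.
Qed.

Lemma user_signal0 p : user_signal p 0 = 0.
Proof. by rewrite -(scale0r 0) (user_signalZ 0) expr0n mul0r. Qed.

Lemma noise0 lam p : noise lam p 0 = 0.
Proof. by rewrite -(scale0r 0) (noiseZ _ 0) expr0n mul0r. Qed.

Lemma noise_gt0 lam p f : nonneg_reals lam -> f != 0 -> 0 < noise lam p f.
Proof.
move=> lam0 f0; apply: lt_le_trans (noise_interference_lb _ _ _ _ _ _) => //.
  by rewrite mulr_gt0 // sqnorm_gt0.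
exact: user_gain_ge0.
Qed.

(** The thermal noise [alpha ^+ 2 * sqnorm f] and the identity part of the quantization covariance,
    [alpha * (1 - alpha) * sqnorm f], add up to the constant term [alpha * sqnorm f]. *)
Lemma sinr_ulE lam i u f :
  sinr_ul h alpha lam i u f =
  lam i u * user_signal (i, u) f / noise lam (i, u) f.
Proof.
rewrite /sinr_ul; congr (_ / _); first by rewrite /user_signal [RHS]mulrCA mulrA.
rewrite /noise_cov_ul (quad_form_diag_part _ _ (channel_gram_diag h lam i)).
rewrite /noise_interference.
have -> : \sum_q lam q.1 q.2 * user_gain (i, u) q f =
    alpha ^+ 2 * (\sum_(q : user | q != (i, u))
      lam q.1 q.2 * sqmod (inner f (h i q.1 q.2)))
    + \sum_q lam q.1 q.2 * quant_gain i q f.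
  rewrite mulr_sumr [X in _ = X + _]big_mkcond /= -big_split /=.
  apply: eq_bigr => q _; rewrite mulrDr; congr (_ + _).
  by case: eqP => _ /=; rewrite ?mulr0 // mulrCA.
have -> : \sum_k (\sum_(q : user) lam q.1 q.2 * sqmod (h i q.1 q.2 k 0) + 1)
      * sqmod (f k 0) =
    \sum_(q : user) lam q.1 q.2 *
      (\sum_k sqmod (h i q.1 q.2 k 0) * sqmod (f k 0)) + sqnorm f.
  under eq_bigr do rewrite mulrDl mul1r mulr_suml.
  rewrite big_split /= -sqnormE exchange_big /=; congr (_ + _).
  apply: eq_bigr => q _; rewrite mulr_sumr.
  by apply: eq_bigr => k _; rewrite mulrA.
have -> : \sum_q lam q.1 q.2 * quant_gain i q f = alpha * (1 - alpha) *
    \sum_(q : user) lam q.1 q.2 *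
      (\sum_k sqmod (h i q.1 q.2 k 0) * sqmod (f k 0)).
  by rewrite mulr_sumr; apply: eq_bigr => q _; rewrite /quant_gain mulrCA.
ring.
Qed.

(** The downlink uses the uplink gains with the two users interchanged. *)
Lemma dl_noise_interferenceE w i u :
  alpha ^+ 2 * interference_dl h w i u + quant_noise_dl h alpha w i u =
  \sum_q user_gain q (i, u) (w q.1 q.2).
Proof.
rewrite /user_gain big_split /=; congr (_ + _).
  rewrite /interference_dl mulr_sumr big_mkcond /=.
  by apply: eq_bigr => q _; rewrite [(i, u) == q]eq_sym; case: eqP.
rewrite /quant_noise_dl.
rewrite -(pair_bigA _ (fun j v => quant_gain j (i, u) (w j v))) /=.
apply: eq_bigr => j _.
rewrite /noise_cov_dl (quad_form_diag_part _ _ (precoder_gram_diag w j)).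
rewrite /quant_gain -mulr_sumr exchange_big /=; congr (_ * _).
apply: eq_bigr => k _; rewrite mulr_suml.
by apply: eq_bigr => v _; rewrite mulrC.
Qed.

Lemma P2_constraintE w i u :
  P2_constraint h alpha gamma w i u =
  user_signal (i, u) (w i u) / gamma i u
  - \sum_q user_gain q (i, u) (w q.1 q.2) - 1.
Proof.
by rewrite -dl_noise_interferenceE /P2_constraint /user_signal; ring.
Qed.

Lemma P2_feasibleE w :
  P2_feasible h alpha gamma w <->
  forall i u, 0 <= P2_constraint h alpha gamma w i u.
Proof.
suff eq_c i u : (gamma i u <= sinr_dl h alpha w i u) =
    (0 <= P2_constraint h alpha gamma w i u).
  by split=> feas i u; move: (feas i u); rewrite eq_c.
rewrite P2_constraintE /sinr_dl dl_noise_interferenceE.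
rewrite ler_pdivlMr; last first.
  by rewrite ltr_wpDl // sumr_ge0 // => q _; apply: user_gain_ge0.
by rewrite -addrA -opprD subr_ge0 ler_pdivlMr // mulrC.
Qed.

(** * The Lagrangian, the dual function and the uplink constraints *)

Lemma P2_lagrangianE mu w :
  P2_lagrangian h alpha gamma mu w =
  \sum_i \sum_u mu i u +
  \sum_p (noise mu p (w p.1 p.2)
          - mu p.1 p.2 * user_signal p (w p.1 p.2) / gamma p.1 p.2).
Proof.
rewrite /P2_lagrangian /P2_objective !pair_bigA /= mulr_sumr.
under [X in _ - X]eq_bigr => p _.
  rewrite P2_constraintE -surjective_pairing !mulrBr mulr1 mulr_sumr mulrA.
  over.
(* Exchanging the sums transposes the gains: each precoder now meets the uplink noise at powers
   [mu], with the transmit power as its constant term. *)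
rewrite sumrB big_split /= sumrN exchange_big /= sumrB.
rewrite /noise_interference big_split /=.
by ring.
Qed.

Lemma max_sinr_ul_geP lam :
  nonneg_reals lam ->
  (forall i u, ((gamma i u)%:E <= max_sinr_ul h alpha lam i u)%E) <->
  ul_feasible lam.
Proof.
move=> lam0.
have geE i u f g : f != 0 -> (g < sinr_ul h alpha lam i u f) =
    (g * noise lam (i, u) f < lam i u * user_signal (i, u) f).
  by move=> f0; rewrite sinr_ulE ltr_pdivlMr // noise_gt0.
split=> [ge_max [i u] g /= lt_g|ge_sinr i u].
  have : (g%:E < max_sinr_ul h alpha lam i u)%E.
    by apply: lt_le_trans (ge_max i u); rewrite lte_fin.
  move=> /ereal_sup_gt[_ [f /= f0 <-]]; rewrite lte_fin geE // => lt_f.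
  by exists f.
rewrite leNgt; apply/negP => lt_max.
have ex_f g : g < gamma i u -> exists2 f, f != 0 & g < sinr_ul h alpha lam i u f.
  move=> /(ge_sinr (i, u))[f lt_f].
  have f0 : f != 0.
    by apply: contraTneq lt_f => ->; rewrite user_signal0 noise0 !mulr0 ltxx.
  by exists f; rewrite // geE.
have le_max f : f != 0 ->
    ((sinr_ul h alpha lam i u f)%:E <= max_sinr_ul h alpha lam i u)%E.
  by move=> f0; apply: ereal_sup_ubound; exists f.
(* A nonzero combiner excludes the value [-oo] of the supremum. *)
have [f0 f0_neq0 _] : exists2 f, f != 0 & -1 < sinr_ul h alpha lam i u f.
  by apply: ex_f; apply: lt_trans (gamma_gt0 i u); rewrite ltrN10.
move: lt_max le_max; case: max_sinr_ul => [r| |] lt_max le_max.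
- have [f f_neq0 lt_f] := ex_f r lt_max.
  by move: (le_max f f_neq0); rewrite lee_fin leNgt lt_f.
- by [].
- by move: (le_max f0 f0_neq0); rewrite leeNy_eq.
Qed.

(** Every quadratic form is nonnegative here, so the zero precoders attain the infimum. *)
Lemma P2_dual_function_le mu :
  dual_feasible mu ->
  P2_dual_function h alpha gamma mu = (\sum_i \sum_u mu i u)%:E.
Proof.
move=> mu_le; apply/eqP; rewrite eq_le; apply/andP; split.
  apply: ereal_inf_lbound; exists (fun _ _ => 0) => //=.
  rewrite P2_lagrangianE [X in _ + X]big1 ?addr0 // => p _.
  by rewrite noise0 user_signal0 mulr0 mul0r subr0.
apply: le_ereal_inf_tmp => _ [w _ <-]; rewrite lee_fin P2_lagrangianE.
rewrite lerDl sumr_ge0 // => p _; rewrite subr_ge0 ler_pdivrMr //.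
by rewrite [leRHS]mulrC; apply: mu_le.
Qed.

(* The Lagrangian minus the sum of the multipliers is a homogeneous quadratic:
   where it is negative, scaling the precoder makes it unbounded below. *)
Lemma P2_dual_function_nle mu :
  ~ dual_feasible mu ->
  P2_dual_function h alpha gamma mu = -oo%E.
Proof.
move=> /existsNP[p /existsNP[f /negP]]; rewrite -ltNge => lt_f.
pose s := mu p.1 p.2 * user_signal p f / gamma p.1 p.2 - noise mu p f.
have s_gt0 : 0 < s by rewrite subr_gt0 ltr_pdivlMr // mulrC.
have le_inf c : 0 <= c -> (P2_dual_function h alpha gamma mu <=
    (\sum_i \sum_u mu i u - c * s)%:E)%E.
  move=> c0; apply: ereal_inf_lbound.
  (* Only user [p] transmits; the square root makes the quadratic form scale by [c]. *)
  pose t j v := if (j, v) == p then Num.sqrt c else 0.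
  exists (fun j v => (t j v)%:C *: f) => //=.
  congr (_%:E); rewrite P2_lagrangianE; congr (_ + _).
  rewrite (bigD1 p) //= big1 ?addr0 => [|q q_neq_p];
    rewrite noiseZ user_signalZ /t -surjective_pairing.
    by rewrite eqxx sqr_sqrtr // /s; ring.
  by rewrite (negbTE q_neq_p) expr0n !mul0r mulr0 mul0r subr0.
apply/eqP; rewrite eq_le leNye andbT leNgt; apply/negP.
case E : P2_dual_function le_inf => [r| |] le_inf // _.
  (* Chosen so that the Lagrangian drops to at most [r - 1]. *)
  pose c := Num.max 0 ((\sum_i \sum_u mu i u - r + 1) / s).
  have := le_inf c; rewrite le_max lexx lee_fin => /(_ isT).
  have : (\sum_i \sum_u mu i u - r + 1) <= c * s.
    by rewrite -ler_pdivrMr // le_max lexx orbT.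
  by lra.
by have := le_inf 0 (lexx 0); rewrite leye_eq.
Qed.

(** * Comparison of P1 with the dual *)

Lemma P1_dual_dominated lam mu :
  nonneg_reals lam -> nonneg_reals mu -> ul_feasible lam -> dual_feasible mu ->
  forall i u, mu i u <= lam i u.
Proof.
move=> lam0 mu0 lam_ge mu_le i u.
exact: (sinr_le_ge_dominated alpha_gt0 (fun p => gamma_gt0 p.1 p.2)
  user_gain_ge0 gain_bound_ge0 user_gain_le (fun p => lam0 p.1 p.2)
  (fun p => mu0 p.1 p.2) lam_ge mu_le (i, u)).
Qed.

Let curryK (lam : user -> R) : (fun p => lam (p.1, p.2)) = lam.
Proof. by apply/funext => p; rewrite -surjective_pairing. Qed.

(** A bound on the total power of dual feasible points yields a greatest one, which then also meets
    the uplink targets. *)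
Lemma P1_dual_dichotomy :
  (exists lam, [/\ nonneg_reals lam, ul_feasible lam & dual_feasible lam]) \/
  (forall M, exists mu,
     [/\ nonneg_reals mu, dual_feasible mu & M < \sum_i \sum_u mu i u]).
Proof.
have [?|/existsNP[M no_mu]] := pselect (forall M, exists mu,
  [/\ nonneg_reals mu, dual_feasible mu & M < \sum_i \sum_u mu i u]);
  [by right|left].
have [|lam [lam0 lam_le lam_max]] :=
    @sinr_le_greatest _ _ _ alpha (flat gamma) (@sqnorm R Nb) user_signal
      user_gain alpha_gt0 (fun p => gamma_gt0 p.1 p.2) (@sqnorm_ge0 R Nb)
      user_gain_ge0 user_signal_ge0 M.
  move=> mu mu0 mu_le; rewrite leNgt; apply/negP => lt_mu; apply: no_mu.
  exists (fun i u => mu (i, u)); split; first by move=> i u; apply: mu0.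
    by rewrite curryK.
  by rewrite pair_bigA; under eq_bigr do rewrite -surjective_pairing.
exists (fun i u => lam (i, u)); rewrite curryK; split=> //.
exact: (sinr_le_greatest_ge alpha_gt0 (fun p => gamma_gt0 p.1 p.2)
  (@sqnorm_ge0 R Nb) user_gain_ge0 gain_bound_ge0 user_signal_le lam0 lam_le).
Qed.

(** Source of uniqueness: optimality compares totals, while feasibility compares coordinates. *)
Lemma le_sum_eq lam mu :
  (forall i u, lam i u <= mu i u) ->
  \sum_i \sum_u mu i u <= \sum_i \sum_u lam i u -> mu = lam.
Proof.
move=> le_lam; rewrite !pair_bigA /= => le_mu.
have : \sum_p (mu p.1 p.2 - lam p.1 p.2) == 0.
  rewrite eq_le sumrB subr_le0 le_mu subr_ge0 /=.
  by apply: ler_sum => p _; apply: le_lam.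
rewrite psumr_eq0 => [/allP eq0|p _]; last by rewrite subr_ge0.
apply/funext => i; apply/funext => u.
by apply/eqP; rewrite -subr_eq0; apply: (eq0 (i, u)); rewrite mem_index_enum.
Qed.

Lemma P1_feasibleE w lam :
  P1_feasible h alpha gamma (w, lam) <->
  [/\ forall i u, w i u != 0, nonneg_reals lam & ul_feasible lam].
Proof.
by split=> -[f0 lam0 lam_ge]; split=> //; apply/max_sinr_ul_geP.
Qed.

Lemma P2_dual_function_ub mu :
  (P2_dual_function h alpha gamma mu <= (\sum_i \sum_u mu i u)%:E)%E.
Proof.
have [/P2_dual_function_le ->|/P2_dual_function_nle ->] :=
  pselect (dual_feasible mu); by rewrite ?leNye.
Qed.

(** Weak duality between P1 and the dual. *)
Lemma P2_dual_function_le_bound lam mu :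
  nonneg_reals lam -> ul_feasible lam -> nonneg_reals mu ->
  (P2_dual_function h alpha gamma mu <= (\sum_i \sum_u lam i u)%:E)%E.
Proof.
move=> lam0 lam_ge mu0.
have [mu_le|/P2_dual_function_nle ->] := pselect (dual_feasible mu);
  last by rewrite leNye.
rewrite P2_dual_function_le // lee_fin.
by do 2![apply: ler_sum => ? _]; apply: P1_dual_dominated.
Qed.

(** * Bounded dual: a common unique optimum *)

Section Attained.
Variable lam : user_reals R Nc Nu.
Hypotheses (lam0 : nonneg_reals lam) (lam_ge : ul_feasible lam).
Hypothesis lam_le : dual_feasible lam.
(** Any nonzero combiners complete [lam] to a feasible point, as the constraint itself maximizes
    over combiners. *)
Variable f : user_vectors R Nc Nu Nb.
Hypothesis f_neq0 : forall i u, f i u != 0.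

Let P1_ge y : P1_feasible h alpha gamma y ->
  forall i u, lam i u <= y.2 i u.
Proof.
by case: y => g mu /P1_feasibleE[_ mu0 mu_ge]; apply: P1_dual_dominated.
Qed.

Lemma P1_value_attained :
  P1_value h alpha gamma = (\sum_i \sum_u lam i u)%:E.
Proof.
apply/eqP; rewrite eq_le; apply/andP; split.
  by apply: ereal_inf_lbound; exists (f, lam) => //; apply/P1_feasibleE.
apply: le_ereal_inf_tmp => _ [y /P1_ge le_y <-]; rewrite lee_fin.
by do 2![apply: ler_sum => ? _].
Qed.

Lemma P2_dual_value_attained :
  P2_dual_value h alpha gamma = (\sum_i \sum_u lam i u)%:E.
Proof.
apply/eqP; rewrite eq_le; apply/andP; split.
  by apply: ge_ereal_sup => _ [mu mu0 <-]; apply: P2_dual_function_le_bound.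
by apply: ereal_sup_ubound; exists lam => //; rewrite P2_dual_function_le.
Qed.

Lemma P1_optimalP mu :
  (exists g, P1_optimal h alpha gamma (g, mu)) <-> mu = lam.
Proof.
split=> [[g [g_feas g_min]]|->].
  apply: le_sum_eq; first exact: (P1_ge g_feas).
  by apply: (g_min (f, lam)); apply/P1_feasibleE.
exists f; split; first exact/P1_feasibleE.
by move=> y /P1_ge le_y; do 2![apply: ler_sum => ? _].
Qed.

Lemma P2_dual_optimalP mu : P2_dual_optimal h alpha gamma mu <-> mu = lam.
Proof.
split=> [[mu0 mu_max]|->]; last first.
  split=> // nu nu0; rewrite [leRHS]P2_dual_function_le //.
  exact: P2_dual_function_le_bound.
have := mu_max _ lam0; rewrite P2_dual_function_le //.
have [mu_le|/P2_dual_function_nle ->] := pselect (dual_feasible mu); last by [].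
rewrite P2_dual_function_le // lee_fin => le_mu.
by apply/esym/le_sum_eq => //; apply: P1_dual_dominated.
Qed.

End Attained.

(** * Unbounded dual: both values are infinite and neither problem has an optimum *)

Section Unbounded.
Hypothesis unbounded : forall M, exists mu,
  [/\ nonneg_reals mu, dual_feasible mu & M < \sum_i \sum_u mu i u].

Lemma P1_infeasible y : ~ P1_feasible h alpha gamma y.
Proof.
case: y => f lam /P1_feasibleE[_ lam0 lam_ge].
have [mu [mu0 mu_le]] := unbounded (\sum_i \sum_u lam i u).
rewrite ltNge => /negP; apply; do 2![apply: ler_sum => ? _].
exact: P1_dual_dominated.
Qed.

Lemma P1_value_infeasible : P1_value h alpha gamma = +oo%E.
Proof. by apply/ereal_inf_pinfty => ? [? /P1_infeasible]. Qed.

Lemma P2_dual_value_unbounded : P2_dual_value h alpha gamma = +oo%E.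
Proof.
apply/eqyP => M _; have [mu [mu0 mu_le /ltW lt_mu]] := unbounded M.
apply: le_ereal_sup_tmp; exists (P2_dual_function h alpha gamma mu).
  by exists mu.
by rewrite P2_dual_function_le.
Qed.

Lemma P2_dual_not_optimal mu : ~ P2_dual_optimal h alpha gamma mu.
Proof.
move=> [mu0 mu_max].
have [nu [nu0 nu_le]] := unbounded (\sum_i \sum_u mu i u).
rewrite ltNge -lee_fin -P2_dual_function_le // => /negP; apply.
exact: le_trans (mu_max _ nu0) (P2_dual_function_ub mu).
Qed.

End Unbounded.
End Network.

Theorem theorem1 (R : realType) (Nc Nu Nb : nat)
  (hNc : (0 < Nc)%N) (hNu : (0 < Nu)%N) (hNb : (0 < Nb)%N)
  (h : channels R Nc Nu Nb) (alpha : R) (halpha0 : 0 < alpha)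
  (halpha1 : alpha <= 1) (gamma : user_reals R Nc Nu)
  (hgamma : forall i u, 0 < gamma i u) :
  [/\ (forall w : user_vectors R Nc Nu Nb,
         P2_feasible h alpha gamma w <->
         (forall i u, 0 <= P2_constraint h alpha gamma w i u)),
      P1_value h alpha gamma = P2_dual_value h alpha gamma
    & (forall lam : user_reals R Nc Nu,
         (exists f : user_vectors R Nc Nu Nb,
            P1_optimal h alpha gamma (f, lam)) <->
         P2_dual_optimal h alpha gamma lam)].
Proof.
(* With at least one antenna, the all-ones vector is an admissible combiner. *)
have f_neq0 (i : 'I_Nc) (u : 'I_Nu) : (const_mx 1 : 'cV[R[i]]_Nb) != 0.
  apply/eqP => /matrixP eq0; have := eq0 (Ordinal hNb) 0.
  by rewrite !mxE => /eqP; rewrite oner_eq0.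
have [[lam' [lam0 lam_ge lam_le]]|unb] :=
  P1_dual_dichotomy h halpha0 halpha1 hgamma.
- split=> [w||lam]; first exact: P2_feasibleE.
    have -> := P1_value_attained halpha0 halpha1 hgamma lam0 lam_ge lam_le f_neq0.
    by rewrite (P2_dual_value_attained halpha0 halpha1 hgamma lam0 lam_ge lam_le).
  apply: iff_trans (iff_sym _).
    exact: (P1_optimalP halpha0 halpha1 hgamma lam0 lam_ge lam_le f_neq0).
  exact: (P2_dual_optimalP halpha0 halpha1 hgamma lam0 lam_ge lam_le).
- split=> [w||lam]; first exact: P2_feasibleE.
    by rewrite P1_value_infeasible // P2_dual_value_unbounded.
  split=> [[f [f_feas _]]|opt].
    by have := P1_infeasible halpha0 halpha1 hgamma unb f_feas.
  by have := P2_dual_not_optimal hgamma unb opt.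
Qed.
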